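(* Let $c\ne0$, $m\ge4$, $r\ge2$, let $(N^{m-1}(c),g)$ be an $(m-1)$-dimensional Riemannian space form and equip $\mathbb{R}\times N^{m-1}(c)$ with the Lorentzian metric $g_{\mathrm{prod}}=-dt^2+g$. Let $\alpha(s)$ be a proper $r$-harmonic $3$-Frenet helix in $N^{m-1}(c)$, parametrized by its arc length. Then, choosing $d_1,d_2\ne0$ such that $d_1^2=d_2^2+1$, the curve $$\gamma(s)=(d_1s,\alpha(d_2s))$$ is a time-like, proper $r$-harmonic helix in $(\mathbb{R}\times N^{m-1}(c),g_{\mathrm{prod}})$.
   Context: Conventions. For a (semi-)Riemannian manifold $(M,\langle\,,\rangle)$ with Levi-Civita connection $\nabla$, $R(X,Y)Z=\nabla_X\nabla_YZ-\nabla_Y\nabla_XZ-\nabla_{[X,Y]}Z$. Curves are smooth, nonnull, parametrized by arc length on an open interval; $T=\gamma'$, $\langle T,T\rangle=\epsilon_1=\pm1$; time-like means $\epsilon_1=-1$. Put $\nabla_T^0T=T$, $\nabla_T^jT=\nabla_T(\nabla_T^{j-1}T)$. For $r\ge2$, a curve is $r$-harmonic if $$\tau_r(\gamma)=\nabla^{2r-1}_T T+\sum_{\ell=0}^{r-2}(-1)^\ell R\big(\nabla^{2r-3-\ell}_T T,\nabla^{\ell}_T T\big)T=0,$$ and proper $r$-harmonic if it is $r$-harmonic and not a geodesic. A $3$-Frenet curve is a curve admitting a frame $\{F_1=T,F_2=N,F_3=B\}$ along it with $\langle F_i,F_i\rangle=\epsilon_i=\pm1$, $\langle F_i,F_j\rangle=0$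 for $i\ne j$, and $\nabla_TT=\epsilon_2kN$, $\nabla_TN=-\epsilon_1kT+\epsilon_3\tau B$, $\nabla_TB=-\epsilon_2\tau N$, where the curvatures $k(s)$ and $\tau(s)$ are positive functions (if the ambient manifold is oriented of dimension $3$, $\tau$ is allowed to take any real value, $B$ being fixed by requiring the frame to be positively oriented). In a Riemannian manifold all $\epsilon_i=1$. It is a ($3$-Frenet) helix if the curvatures are constant. The Riemannian space form $N^{m-1}(c)$ has constant sectional curvature $c$: $R(X,Y)Z=c(g(Y,Z)X-g(X,Z)Y)$. *)

(* Defs.v *)
From HB Require Import structures.
From mathcomp Require Import all_boot all_order all_algebra.
From mathcomp Require Import all_classical all_reals all_analysis.
From mathcomp Require Import ring.

Set Implicit Arguments.
Unset Strict Implicit.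
Unset Printing Implicit Defensive.

Import Order.TTheory GRing.Theory Num.Theory.
Import numFieldNormedType.Exports.

Local Open Scope classical_set_scope.
Local Open Scope ring_scope.

Section Smooth.
Context {R : realType}.

Definition pderiv n (W : normedModType R) (i : 'I_n) (f : 'rV[R]_n -> W) :
    'rV[R]_n -> W :=
  fun x => 'D_(delta_mx 0 i) f x.

Definition pderivs n (W : normedModType R) (s : seq 'I_n) (f : 'rV[R]_n -> W) :
    'rV[R]_n -> W :=
  foldl (fun h i => pderiv i h) f s.

(* Meant for open [U]; the values of [f] outside [U] are then irrelevant. *)
Definition smooth_on n (W : normedModType R) (U : set 'rV[R]_n)
    (f : 'rV[R]_n -> W) :=
  forall (s : seq 'I_n) x, U x -> differentiable (pderivs s f) x.

Section Linear.
Variables (V W X : normedModType R) (L : {linear W -> X}).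
Hypothesis L_cont : continuous L.

Lemma is_derive_lin (f : V -> W) (x v : V) :
  derivable f x v -> is_derive x v (L \o f) (L ('D_v f x)).
Proof.
move=> df; have cv : (fun h => h^-1 *: (((L \o f) \o shift x) (h *: v) -
    (L \o f) x)) @ 0^' --> L ('D_v f x).
  rewrite (_ : (fun h => _) =
    L \o (fun h : R => h^-1 *: ((f \o shift x) (h *: v) - f x))).
    by apply: continuous_cvg; [exact: L_cont | exact: df].
  by apply/funext => h /=; rewrite linearZ [L (_ - _)]linearB.
by split; [apply/cvg_ex; eexists; exact: cv | exact: (cvg_lim _ cv)].
Qed.

End Linear.

Lemma near_differentiable (V W : normedModType R) (f g : V -> W) (x : V) :
  (\forall y \near x, f y = g y) -> differentiable f x -> differentiable g x.
Proof.
move=> fg df; have [dfc dfx] := (diff_locallyP x f).1 df.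
have gx : g \o shift x = cst (g x) + 'd f x +o_ 0 id.
  apply/eqaddoP => e e0; move/eqaddoP: dfx => /(_ e e0).
  have : \forall h \near (0 : V), f (h + x) = g (h + x).
    have /= := near_shift 0 x (fun y => f y = g y).
    by rewrite subr0 => <-.
  move=> H1; apply: filterS2 H1 => h /= H1.
  by rewrite /= !fctE /= H1 (nbhs_singleton fg).
by apply/diff_locallyP; rewrite (diff_unique dfc gx).
Qed.

Section SmoothLemmas.
Context {n : nat}.
Implicit Types (U : set 'rV[R]_n) (W X : normedModType R).

Lemma smooth_on_pderiv W U (f : 'rV[R]_n -> W) i :
  smooth_on U f -> smooth_on U (pderiv i f).
Proof. by move=> fs s x Ux; exact: (fs (i :: s)). Qed.

Lemma smooth_on_differentiable W U (f : 'rV[R]_n -> W) x :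
  smooth_on U f -> U x -> differentiable f x.
Proof. by move=> fs; exact: (fs [::]). Qed.

Lemma smooth_on_near W U (P : 'rV[R]_n -> Prop) x :
  open U -> (forall y, U y -> P y) -> U x -> \forall y \near x, P y.
Proof.
by move=> oU UP Ux; apply: filterS UP _; apply: open_nbhs_nbhs.
Qed.

Lemma smooth_on_lin W X (L : {linear W -> X}) U (f : 'rV[R]_n -> W) :
  continuous L -> open U -> smooth_on U f -> smooth_on U (L \o f).
Proof.
move=> Lc oU fs s; have : forall y, U y -> (L \o f) y = L (f y) by [].
move: (L \o f) => h; elim: s f h fs => [|i s IH] f h fs hE x Ux /=.
  apply: (near_differentiable (f := L \o f)).
    by apply: smooth_on_near Ux => // y /hE ->.
  apply: differentiable_comp; first exact: smooth_on_differentiable Ux.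
  exact: linear_differentiable.
apply: (IH (pderiv i f)) Ux; first exact: smooth_on_pderiv.
move=> y Uy; rewrite /pderiv (@near_eq_derive _ _ _ h (L \o f)).
  apply: (@derive_val _ _ _ _ _ _ _ (is_derive_lin Lc _)).
  by apply: diff_derivable; exact: smooth_on_differentiable Uy.
by apply: smooth_on_near Uy.
Qed.

Lemma smooth_on_add W U (f g : 'rV[R]_n -> W) :
  open U -> smooth_on U f -> smooth_on U g -> smooth_on U (f \+ g).
Proof.
move=> oU fs gs s; have : forall y, U y -> (f \+ g) y = f y + g y by [].
move: (f \+ g) => h; elim: s f g h fs gs => [|i s IH] f g h fs gs hE x Ux /=.
  apply: (near_differentiable (f := f + g)).
    by apply: smooth_on_near Ux => // y /hE ->.
  by apply: differentiableD; exact: smooth_on_differentiable Ux.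
apply: (IH (pderiv i f) (pderiv i g)) Ux; [exact: smooth_on_pderiv..|].
move=> y Uy; rewrite /pderiv (@near_eq_derive _ _ _ h (f + g)).
  by apply: deriveD; apply: diff_derivable; exact: smooth_on_differentiable Uy.
by apply: smooth_on_near Uy.
Qed.

Lemma smooth_on_cst W U (a : W) : smooth_on U (cst a).
Proof.
move=> s; elim: s a => [|i s IH] a x Ux //=.
rewrite (_ : pderiv i (cst a) = cst 0); first exact: IH.
by apply/funext => y; exact: derive_cst.
Qed.

Lemma smooth_on_linear W (L : {linear 'rV[R]_n -> W}) U :
  continuous L -> smooth_on U L.
Proof.
move=> Lc [|i s] x Ux /=; first exact: linear_differentiable.
rewrite (_ : pderiv i L = cst (L (delta_mx 0 i))).
  by have := @smooth_on_cst W U (L (delta_mx 0 i)) s x Ux.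
apply/funext => y; rewrite /pderiv deriveE; last exact: linear_differentiable.
by rewrite diff_lin.
Qed.

End SmoothLemmas.

Lemma derive_rsubmx m n (W : normedModType R) (f : 'rV[R]_n -> W)
    (x v : 'rV[R]_(m + n)) :
  'D_v (f \o rsubmx) x = 'D_(rsubmx v) f (rsubmx x).
Proof.
rewrite /derive (_ : (fun h : R => _) = fun h : R => h^-1 *:
  ((f \o shift (rsubmx x)) (h *: rsubmx v) - f (rsubmx x))) //.
apply/funext => h /=; congr (_ *: (f _ - _)).
by apply/rowP => k; rewrite !mxE.
Qed.

Lemma smooth_on_rsubmx m n (W : normedModType R) U (f : 'rV[R]_n -> W) :
  smooth_on U f ->
  smooth_on (rsubmx @^-1` U) (f \o rsubmx : 'rV[R]_(m + n) -> W).
Proof.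
move=> fs s; elim: s f fs => [|i s IH] f fs x Ux /=.
  apply: differentiable_comp; first exact: differentiable_rsubmx.
  exact: (smooth_on_differentiable (x := rsubmx x) fs Ux).
case: (splitP i) => [j|j] ij.
  rewrite (_ : pderiv i _ = cst 0).
    by have := @smooth_on_cst _ W (rsubmx @^-1` U) 0 s x Ux.
  apply/funext => y; rewrite /pderiv derive_rsubmx.
  suff -> : rsubmx (delta_mx 0 i) = 0 :> 'rV[R]_n by exact: derive0.
  apply/rowP => k; rewrite !mxE eqxx /=; case: eqP => //= ki.
  by move: (ltn_ord j); rewrite -ij -ki /= ltnNge leq_addr.
rewrite (_ : pderiv i _ = pderiv j f \o rsubmx).
  by apply: IH Ux; exact: smooth_on_pderiv.
apply/funext => y; rewrite /pderiv derive_rsubmx; congr ('D_ _ f _).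
apply/rowP => k; rewrite !mxE; congr ((_ && _)%:R).
by rewrite -!val_eqE /= ij eqn_add2l.
Qed.

Lemma linear_mx_continuous m n (W : normedModType R)
    (L : {linear 'M[R]_(m, n) -> W}) : continuous L.
Proof.
move=> x; rewrite (_ : L = (fun u => \sum_i \sum_j u i j *: L (delta_mx i j)) :> (_ -> _)).
  apply: (cvg_big (F := nbhs x) add_continuous (@nbhs_filter _ x)) => i _.
  apply: (cvg_big (F := nbhs x) add_continuous (@nbhs_filter _ x)) => j _.
  by apply: cvgZr_tmp; exact: coord_continuous.
apply/funext => u; rewrite {1}(matrix_sum_delta u) linear_sum /=.
by apply: eq_bigr => i _; rewrite linear_sum; apply: eq_bigr => j _; rewrite linearZ.
Qed.

End Smooth.

Record manifold (R : realType) (n : nat) := Manifold {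
  carrier :> topologicalType;
  chart : Type;
  dom : chart -> set carrier;
  coord : chart -> carrier -> 'rV[R]_n;
  param : chart -> 'rV[R]_n -> carrier;
  manifold_hausdorff : hausdorff_space carrier;
  manifold_second_countable : @second_countable carrier;
  dom_cover : forall p, exists c, dom c p;
  dom_open : forall c, open (dom c);
  codom_open : forall c, open (coord c @` dom c);
  coordK : forall c p, dom c p -> param c (coord c p) = p;
  chart_continuous : forall c p, dom c p -> {for p, continuous (coord c)};
  chart_inv_continuous :
    forall c x, (coord c @` dom c) x -> {for x, continuous (param c)};
  transition_smooth : forall c d,
    smooth_on (coord c @` (dom c `&` dom d)) (coord d \o param c)
}.

Arguments dom {R n m} c.
Arguments coord {R n m} c.
Arguments param {R n m} c.

Definition codom R n (M : manifold R n) (c : chart M) : set 'rV[R]_n :=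
  coord c @` dom c.

(* Row vectors: [v *m chart_jac c d p] are the components in the chart [d] of
   the tangent vector at [p] whose components in the chart [c] are [v]. *)
Definition chart_jac R n (M : manifold R n) (c d : chart M) (p : M) : 'M[R]_n :=
  jacobian (coord d \o param c) (coord c p).

Record metric R n (M : manifold R n) := Metric {
  gram : chart M -> 'rV[R]_n -> 'M[R]_n;
  gram_smooth : forall c, smooth_on (codom c) (gram c);
  gram_sym : forall c x, codom c x -> (gram c x)^T = gram c x;
  gram_unit : forall c x, codom c x -> gram c x \in unitmx;
  gram_change : forall c d p, dom c p -> dom d p ->
    gram c (coord c p) =
    chart_jac c d p *m gram d (coord d p) *m (chart_jac c d p)^T
}.

Section Geometry.
Context {R : realType} {n : nat} {M : manifold R n} (g : metric M).
Implicit Types (c : chart M) (x u v w : 'rV[R]_n).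

(* A tangent vector at the point with coordinates [x] in the chart [c] is given
   by its components in that chart. *)
Definition inner (c : chart M) (x u v : 'rV[R]_n) : R :=
  (u *m gram g c x *m v^T) 0 0.

Definition riemannian :=
  forall c x, codom c x -> forall v, v != 0 -> 0 < inner c x v v.

Definition dgram (c : chart M) (i j l : 'I_n) : 'rV[R]_n -> R :=
  pderiv i (fun y => gram g c y j l).

(* [christoffel c x k i j] is $\Gamma^k_{ij}$ *)
Definition christoffel (c : chart M) (x : 'rV[R]_n) (k i j : 'I_n) : R :=
  2^-1 * \sum_l invmx (gram g c x) k l *
    (dgram c i j l x + dgram c j i l x - dgram c l i j x).

Definition christoffel_map (c : chart M) (x u v : 'rV[R]_n) : 'rV[R]_n :=
  \row_k \sum_i \sum_j christoffel c x k i j * u 0 i * v 0 j.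

Lemma codom_near c x : codom c x -> \forall y \near x, codom c y.
Proof.
by move=> cx; apply: open_nbhs_nbhs; split => //; exact: codom_open.
Qed.

Lemma dgram_sym c i j l x : codom c x -> dgram c i j l x = dgram c i l j x.
Proof.
move=> cx; apply: near_eq_derive; apply: filterS (codom_near cx) => y cy.
by rewrite -[in LHS](gram_sym g cy) mxE.
Qed.

Lemma christoffel_sym c x k i j :
  codom c x -> christoffel c x k i j = christoffel c x k j i.
Proof.
move=> cx; congr (_ * _); apply: eq_bigr => l _; congr (_ * _).
by rewrite (dgram_sym l i j cx) [dgram c i j l x + _]addrC.
Qed.

Lemma christoffel_lower c x i j k : codom c x ->
  \sum_l christoffel c x l k i * gram g c x l j =
  2^-1 * (dgram c k i j x + dgram c i k j x - dgram c j k i x).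
Proof.
move=> cx; pose A := \row_p (dgram c k i p x + dgram c i k p x - dgram c p k i x).
transitivity ((2^-1 *: A *m invmx (gram g c x) *m gram g c x) 0 j).
  rewrite [RHS]mxE; apply: eq_bigr => l _; congr (_ * _).
  rewrite /christoffel mulr_sumr !mxE; apply: eq_bigr => p _.
  rewrite !mxE -mulrA [X in _ = _ * X]mulrC; congr (_ * (_ * _)).
  by rewrite -[in LHS](gram_sym g cx) -trmx_inv mxE.
by rewrite mulmxKV ?(gram_unit g cx)// !mxE.
Qed.

Lemma christoffel_metric c x i j k : codom c x ->
  dgram c k i j x =
  \sum_l (christoffel c x l k i * gram g c x l j +
          christoffel c x l k j * gram g c x i l).
Proof.
move=> cx; rewrite big_split /= christoffel_lower//.
under [X in _ + X]eq_bigr => l _ do rewrite -(gram_sym g cx) mxE.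
rewrite christoffel_lower// (dgram_sym k j i cx).
rewrite -mulrDr; set a := dgram c k i j x; set b := dgram c i k j x.
by set d := dgram c j k i x; field.
Qed.

Definition covd (c : chart M) (X Y : 'rV[R]_n -> 'rV[R]_n) :
    'rV[R]_n -> 'rV[R]_n :=
  fun x => 'D_(X x) Y x + christoffel_map c x (X x) (Y x).

Definition lie (X Y : 'rV[R]_n -> 'rV[R]_n) : 'rV[R]_n -> 'rV[R]_n :=
  fun x => 'D_(X x) Y x - 'D_(Y x) X x.

Lemma covd_torsion_free c X Y x :
  codom c x -> covd c X Y x - covd c Y X x = lie X Y x.
Proof.
move=> cx; suff E : christoffel_map c x (X x) (Y x) =
    christoffel_map c x (Y x) (X x) by rewrite /covd E opprD addrACA subrr addr0.
apply/rowP => k; rewrite !mxE exchange_big; apply: eq_bigr => j _.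
by apply: eq_bigr => i _; rewrite christoffel_sym// mulrAC.
Qed.

Definition curvature_field (c : chart M) (X Y Z : 'rV[R]_n -> 'rV[R]_n) :
    'rV[R]_n -> 'rV[R]_n :=
  fun x => covd c X (covd c Y Z) x - covd c Y (covd c X Z) x
    - covd c (lie X Y) Z x.

(* $R(u,v)w$ at a point; [curvature_field] being tensorial, the tangent vectors
   may be extended with constant components. *)
Definition curvature (c : chart M) (x u v w : 'rV[R]_n) : 'rV[R]_n :=
  curvature_field c (cst u) (cst v) (cst w) x.

Definition constant_curvature (k : R) :=
  forall c x, codom c x -> forall u v w,
    curvature c x u v w = k *: (inner c x v w *: u - inner c x u w *: v).

Definition space_form (k : R) := riemannian /\ constant_curvature k.

(* A vector field along a curve is a family [V] of components: [V c s] is only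
   meaningful when the curve lies in the domain of [c] at time [s]. *)
Implicit Types (I : set R) (gamma : R -> M) (V : chart M -> R -> 'rV[R]_n).

Definition times I gamma (c : chart M) : set R :=
  I `&` gamma @^-1` (dom c).

Definition smooth_curve I gamma :=
  (forall s, I s -> {for s, continuous gamma}) /\
  (forall c s, times I gamma c s ->
     forall k, derivable (derive1n k (coord c \o gamma)) s 1).

Definition field_along I gamma V :=
  (forall c s, times I gamma c s -> forall k, derivable (derive1n k (V c)) s 1)
  /\ (forall c d s, times I gamma c s -> dom d (gamma s) ->
     V d s = V c s *m chart_jac c d (gamma s)).

Definition velocity gamma : chart M -> R -> 'rV[R]_n :=
  fun c => derive1 (coord c \o gamma).

Definition covd_along gamma V : chart M -> R -> 'rV[R]_n :=
  fun c s => derive1 (V c) s +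
    christoffel_map c (coord c (gamma s)) (velocity gamma c s) (V c s).

Definition nablaT gamma (j : nat) : chart M -> R -> 'rV[R]_n :=
  iter j (covd_along gamma) (velocity gamma).

Definition inner_along gamma (c : chart M) (s : R) (u v : 'rV[R]_n) : R :=
  inner c (coord c (gamma s)) u v.

Definition is_sign (e : R) := e = 1 \/ e = -1.

Definition arclength_curve I gamma (e1 : R) :=
  [/\ open I, is_interval I & I !=set0] /\
  [/\ smooth_curve I gamma, is_sign e1 &
    forall c s, times I gamma c s ->
      inner_along gamma c s (velocity gamma c s) (velocity gamma c s) = e1].

Definition timelike_curve I gamma := arclength_curve I gamma (-1).

Definition geodesic I gamma :=
  forall c s, times I gamma c s -> nablaT gamma 1 c s = 0.

(* Meant for $r \ge 2$, where no natural number subtraction is truncated. *)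
Definition tension (r : nat) gamma (c : chart M) (s : R) : 'rV[R]_n :=
  nablaT gamma (2 * r - 1) c s +
  \sum_(0 <= l < (r - 1)%N) (-1) ^+ l *:
    curvature c (coord c (gamma s)) (nablaT gamma (2 * r - 3 - l) c s)
      (nablaT gamma l c s) (velocity gamma c s).

Definition harmonic (r : nat) I gamma :=
  forall c s, times I gamma c s -> tension r gamma c s = 0.

Definition proper_harmonic (r : nat) I gamma :=
  harmonic r I gamma /\ ~ geodesic I gamma.

End Geometry.

(* [chart_sign c p] tells whether the chart [c] is negatively oriented at [p] *)
Record orientation R n (M : manifold R n) := Orientation {
  chart_sign : chart M -> M -> bool;
  chart_sign_near : forall c p, dom c p ->
    \forall q \near p, chart_sign c q = chart_sign c p;
  chart_sign_change : forall c d p, dom c p -> dom d p ->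
    0 < (-1) ^+ (chart_sign c p (+) chart_sign d p) * \det (chart_jac c d p)
}.

Section Frenet.
Context {R : realType} {n : nat} {M : manifold R n} (g : metric M).
Implicit Types (c : chart M) (x u v w : 'rV[R]_n).
Implicit Types (I : set R) (gamma : R -> M) (V N B : chart M -> R -> 'rV[R]_n).

Definition frame3_mx (u v w : 'rV[R]_n) : 'M[R]_n :=
  \matrix_i nth 0 [:: u; v; w] i.

Definition positive_frame3 (o : orientation M) I gamma N B :=
  forall c s, times I gamma c s ->
    0 < (-1) ^+ chart_sign o c (gamma s) *
        \det (frame3_mx (velocity gamma c s) (N c s) (B c s)).

Record frenet3 (o : option (orientation M)) I gamma (e1 e2 e3 : R)
    (k tau : R -> R) N B : Prop := Frenet3 {
  frenet_curve : arclength_curve g I gamma e1;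
  frenet_signs : is_sign e2 /\ is_sign e3;
  frenet_N : field_along I gamma N;
  frenet_B : field_along I gamma B;
  frenet_frame : forall c s, times I gamma c s ->
    let ip := inner_along g gamma c s in let T := velocity gamma c s in
    [/\ ip (N c s) (N c s) = e2, ip (B c s) (B c s) = e3, ip T (N c s) = 0,
        ip T (B c s) = 0 & ip (N c s) (B c s) = 0];
  frenet_eq : forall c s, times I gamma c s ->
    [/\ covd_along g gamma (velocity gamma) c s = (e2 * k s) *: N c s,
        covd_along g gamma N c s =
          - (e1 * k s) *: velocity gamma c s + (e3 * tau s) *: B c s &
        covd_along g gamma B c s = - (e2 * tau s) *: N c s];
  frenet_k_gt0 : forall s, I s -> 0 < k s;
  frenet_tau : if o is Some w then n = 3%N /\ positive_frame3 w I gamma N B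
               else forall s, I s -> 0 < tau s
}.

(* With [Some w] the ambient manifold is three-dimensional and oriented by [w],
   and the torsion may be any real number; with [None] it must be positive. *)
Definition helix3 (o : option (orientation M)) I gamma :=
  exists e1 e2 e3 k tau N B,
    frenet3 o I gamma e1 e2 e3 (cst k) (cst tau) N B.

End Frenet.

Lemma hausdorff_prod (S T : topologicalType) :
  hausdorff_space S -> hausdorff_space T -> hausdorff_space (S * T)%type.
Proof.
move=> hS hT [p1 p2] [q1 q2] cl; congr (_, _).
  apply: hS => A B pA qB.
  have [||[x y] [/= [Ax _] [Bx _]]] := cl (A `*` setT) (B `*` setT).
  - by exists (A, setT); rewrite //=; split => //=; exact: filterT.
  - by exists (B, setT); rewrite //=; split => //=; exact: filterT.
  - by exists x.
apply: hT => A B pA qB.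
have [||[x y] [/= [_ Ax] [_ Bx]]] := cl (setT `*` A) (setT `*` B).
- by exists (setT, A); rewrite //=; split => //=; exact: filterT.
- by exists (setT, B); rewrite //=; split => //=; exact: filterT.
- by exists y.
Qed.

Lemma second_countable_prod (S T : topologicalType) :
  @second_countable S -> @second_countable T ->
  @second_countable (S * T)%type.
Proof.
move=> [A cA [Ao Ab]] [B cB [Bo Bb]].
exists ((fun ab => ab.1 `*` ab.2) @` (A `*` B)).
  by apply: sub_countable (card_image_le _ _) _; exact: countableX.
split.
  move=> _ [[a b] /= [Aa Bb'] <-].
  rewrite openE => -[x y] /= [ax by_]; exists (a, b) => //=.
  by split; apply: open_nbhs_nbhs; split => //; [exact: Ao | exact: Bo].
move=> [x y] U [[V W] /= [xV yW] VWU].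
have [a [Aa ax] aV] := Ab x V xV; have [b [Bb' by_] bW] := Bb y W yW.
exists (a `*` b) => /=.
  by split => //; exists (a, b).
by move=> [u v] [/= /aV Vu /bW Wv]; exact: VWU.
Qed.

Lemma second_countable_real (R : realType) : @second_countable R.
Proof.
pose B (qn : rat * nat) : set R := ball (ratr qn.1 : R) (qn.2.+1%:R^-1).
exists (B @` setT).
  by apply: sub_countable (card_image_le _ _) _; exact: countableP.
split; first by move=> _ [qn _ <-]; exact: ball_open.
move=> x U /nbhs_ballP[e /= e0 eU].
have [n _ nE] : exists2 n, True & n.+1%:R^-1 < e / 2.
  exists (Num.truncn (e / 2)^-1) => //; rewrite invf_plt ?posrE ?divr_gt0//.
  exact: truncnS_gt.
have n0 : 0 < n.+1%:R^-1 :> R by rewrite invr_gt0.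
have x_ball : ball x n.+1%:R^-1 !=set0 by exists x; exact: ballxx.
have [y [xy [q _ qy]]] := dense_rat x_ball (ball_open x _).
exists (B (q, n)); first by split; [exists (q, n) | rewrite /B qy; exact: ball_sym].
move=> z; rewrite /B /= qy => yz; apply: eU.
by rewrite [e]splitr; apply: (@ball_triangle _ _ y); apply: le_ball (ltW nE) _ _.
Qed.

Section Product.
Context {R : realType} {n : nat} (M : manifold R n).

Implicit Types (c d : chart M) (p : R * M).

Definition time_dom c : set (R * M) := snd @^-1` dom c.
Definition time_coord c p : 'rV[R]_(1 + n) :=
  row_mx (const_mx p.1) (coord c p.2).
Definition time_param c (x : 'rV[R]_(1 + n)) : R * M :=
  (lsubmx x 0 0, param c (rsubmx x)).

Lemma time_dom_cover p : exists c, time_dom c p.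
Proof. exact: dom_cover. Qed.

Lemma time_dom_open c : open (time_dom c).
Proof.
by apply: open_comp; [move=> p _; exact: cvg_snd | exact: dom_open].
Qed.

Lemma time_coord_image c (A : set M) :
  time_coord c @` (snd @^-1` A) = rsubmx @^-1` (coord c @` A).
Proof.
apply/seteqP; split => [_ [p Ap <-]|x [p Ap px]] /=.
  by exists p.2; rewrite //= row_mxKr.
exists (lsubmx x 0 0, p) => //; rewrite /time_coord /= px -[RHS]hsubmxK.
by congr row_mx; apply/rowP => i; rewrite !ord1 !mxE.
Qed.

Lemma time_codom_open c : open (time_coord c @` time_dom c).
Proof.
rewrite time_coord_image; apply: open_comp; last exact: codom_open.
by move=> x _; exact: continuous_rsubmx.
Qed.

Lemma time_coordK c p : time_dom c p -> time_param c (time_coord c p) = p.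
Proof.
by case: p => t p cp; rewrite /time_param row_mxKl row_mxKr mxE coordK.
Qed.

Definition inl_mx : 'M[R]_(1, 1 + n) := row_mx 1%:M 0.
Definition inr_mx : 'M[R]_(n, 1 + n) := row_mx 0 1%:M.

Lemma row_mx_inE (u : 'rV[R]_1) (v : 'rV[R]_n) :
  row_mx u v = mulmxr inl_mx u + mulmxr inr_mx v.
Proof.
by rewrite /= !mul_mx_row !mulmx0 !mulmx1 add_row_mx add0r addr0.
Qed.

Lemma time_chart_continuous c p : time_dom c p -> {for p, continuous (time_coord c)}.
Proof.
move=> cp; rewrite (_ : time_coord c = fun p =>
    p.1 *: const_mx 1 *m inl_mx + mulmxr inr_mx (coord c p.2)); last first.
  apply/funext => q; rewrite /time_coord row_mx_inE; congr (_ *m _ + _).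
  by apply/rowP => i; rewrite !mxE mulr1.
apply: cvgD.
  apply: (@continuous_cvg _ _ _ _ _ _ (mulmxr inl_mx)).
    exact: linear_mx_continuous.
  by apply: cvgZr_tmp; exact: cvg_fst.
apply: (@continuous_cvg _ _ _ _ _ _ (mulmxr inr_mx)).
  exact: linear_mx_continuous.
apply: (@continuous_cvg _ _ _ _ _ _ (coord c)).
  exact: chart_continuous.
exact: cvg_snd.
Qed.

Lemma time_chart_inv_continuous c x :
  (time_coord c @` time_dom c) x -> {for x, continuous (time_param c)}.
Proof.
rewrite time_coord_image => cx.
apply: (cvg_pair (F := nbhs x) (G := nbhs (lsubmx x 0 0 : R))
  (H := nbhs (param c (rsubmx x)))).
  apply: (@continuous_cvg _ _ _ _ _ _ (fun u : 'rV[R]_1 => u 0 0)).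
    exact: coord_continuous.
  exact: continuous_lsubmx.
apply: (@continuous_cvg _ _ _ _ _ _ (param c)).
  exact: chart_inv_continuous.
exact: continuous_rsubmx.
Qed.

Lemma time_transitionE c d : time_coord d \o time_param c =
  (mulmxr inl_mx \o lsubmx) \+
  (mulmxr inr_mx \o ((coord d \o param c) \o rsubmx)).
Proof.
apply/funext => x /=; rewrite /time_coord /time_param row_mx_inE; congr (_ *m _ + _).
by apply/rowP => i; rewrite !ord1 !mxE.
Qed.

Lemma overlap_open c d : open (coord c @` (dom c `&` dom d)).
Proof.
rewrite (_ : _ @` _ = codom c `&` param c @^-1` dom d).
  apply: (continuous_inP _ (@codom_open _ _ _ c)).1 (@dom_open _ _ _ d).
  by move=> x; rewrite inE; exact: chart_inv_continuous.
apply/seteqP; split => [_ [p [cp dp] <-]|_ [[p cp <-] /=]].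
  by split; [exists p | rewrite /= coordK].
by rewrite coordK// => dp; exists p.
Qed.

Lemma time_transition_smooth c d :
  smooth_on (time_coord c @` (time_dom c `&` time_dom d)) (time_coord d \o time_param c).
Proof.
rewrite time_transitionE -preimage_setI time_coord_image.
have oU : open (rsubmx @^-1` (coord c @` (dom c `&` dom d)) :
    set 'rV[R]_(1 + n)).
  apply: open_comp; last exact: overlap_open.
  by move=> x _; exact: continuous_rsubmx.
apply: smooth_on_add => //.
  by apply: smooth_on_linear; exact: linear_mx_continuous.
apply: smooth_on_lin => //; first exact: linear_mx_continuous.
by apply: smooth_on_rsubmx; exact: transition_smooth.
Qed.

Definition time_product : manifold R (1 + n) := {|
  carrier := (R * M)%type;
  chart := chart M;
  dom := time_dom;
  coord := time_coord;
  param := time_param;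
  manifold_hausdorff :=
    hausdorff_prod (@Rhausdorff R) (@manifold_hausdorff _ _ M);
  manifold_second_countable :=
    second_countable_prod (@second_countable_real R)
      (@manifold_second_countable _ _ M);
  dom_cover := time_dom_cover;
  dom_open := time_dom_open;
  codom_open := time_codom_open;
  coordK := time_coordK;
  chart_continuous := time_chart_continuous;
  chart_inv_continuous := time_chart_inv_continuous;
  transition_smooth := time_transition_smooth
|}.

Lemma time_codomE c (x : 'rV[R]_(1 + n)) :
  codom (c : chart time_product) x = codom c (rsubmx x).
Proof. exact: (congr1 (@^~ x) (time_coord_image c (dom c))). Qed.

Lemma time_chart_jac c d p : dom c p.2 -> dom d p.2 ->
  chart_jac (c : chart time_product) (d : chart time_product) p =
  block_mx 1%:M 0 0 (chart_jac c d p.2).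
Proof.
move=> cp dp; pose f := coord d \o param c.
have df : differentiable f (coord c p.2).
  apply: (smooth_on_differentiable (transition_smooth (c := c) (d := d))).
  by exists p.2.
have Df : differentiable (time_coord d \o time_param c) (time_coord c p).
  apply: (smooth_on_differentiable (time_transition_smooth (c := c) (d := d))).
  by exists p.
apply/row_matrixP => i; rewrite !rowE; set v := delta_mx 0 i.
rewrite -deriveEjacobian// time_transitionE deriveD; last 2 first.
- apply/diff_derivable/linear_differentiable/linear_mx_continuous.
- apply/diff_derivable/differentiable_comp.
    apply: differentiable_comp; first exact: differentiable_rsubmx.
    by rewrite /time_coord row_mxKr.
  exact/linear_differentiable/linear_mx_continuous.
have -> : 'D_v (mulmxr inl_mx \o lsubmx) (time_coord c p) =
    lsubmx v *m inl_mx.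
  have cL : continuous (mulmxr inl_mx \o lsubmx : 'rV[R]_(1 + n) -> _).
    exact: linear_mx_continuous.
  rewrite deriveE; last exact: linear_differentiable.
  by rewrite diff_lin.
have -> : 'D_v (mulmxr inr_mx \o (f \o rsubmx)) (time_coord c p) =
    (rsubmx v *m chart_jac c d p.2) *m inr_mx.
  have cL : continuous (mulmxr inr_mx : 'rV[R]_n -> _).
    exact: linear_mx_continuous.
  have dfr : derivable (f \o rsubmx) (time_coord c p) v.
    apply/diff_derivable/differentiable_comp; first exact: differentiable_rsubmx.
    by rewrite /time_coord row_mxKr.
  rewrite (derive_val (is_derive := is_derive_lin cL dfr)) derive_rsubmx.
  by rewrite /time_coord row_mxKr deriveEjacobian.
rewrite -[v in RHS]hsubmxK mul_row_block !mulmx0 addr0 add0r mulmx1.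
by rewrite row_mx_inE.
Qed.

Variable g : metric M.

Definition time_gram c (x : 'rV[R]_(1 + n)) : 'M[R]_(1 + n) :=
  block_mx (-1)%:M 0 0 (gram g c (rsubmx x)).

Lemma time_gram_smooth (c : chart time_product) :
  smooth_on (codom c) (time_gram c).
Proof.
have -> : codom c = rsubmx @^-1` codom (c : chart M).
  by apply/funext => x; exact: time_codomE.
pose L := mulmx (col_mx 0 1%:M : 'M[R]_(1 + n, n)) \o mulmxr inr_mx.
rewrite (_ : time_gram c = cst (block_mx (-1)%:M 0 0 0) \+
    (L \o (gram g c \o rsubmx))); last first.
  apply/funext => x /=; rewrite /time_gram /L /= /inr_mx mul_mx_row mulmx0.
  rewrite mulmx1 mul_col_row mul0mx mulmx0 mul1mx mul0mx.
  by rewrite add_block_mx !addr0 !add0r.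
have oU : open (rsubmx @^-1` codom (c : chart M) : set 'rV[R]_(1 + n)).
  apply: open_comp; last exact: codom_open.
  by move=> x _; exact: continuous_rsubmx.
apply: smooth_on_add => //; first exact: smooth_on_cst.
apply: smooth_on_lin => //; first exact: linear_mx_continuous.
by apply: smooth_on_rsubmx; exact: gram_smooth.
Qed.

Lemma time_gram_sym (c : chart time_product) x :
  codom c x -> (time_gram c x)^T = time_gram c x.
Proof.
rewrite time_codomE => cx.
by rewrite tr_block_mx !trmx0 tr_scalar_mx (gram_sym g cx).
Qed.

Lemma time_gram_unit (c : chart time_product) x :
  codom c x -> time_gram c x \in unitmx.
Proof.
rewrite time_codomE => cx; rewrite unitmxE det_ublock det_scalar unitrM.
by rewrite unitrX ?unitrN1 //= -unitmxE (gram_unit g cx).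
Qed.

Lemma time_gram_change (c d : chart time_product) p : dom c p -> dom d p ->
  time_gram c (coord c p) =
  chart_jac c d p *m time_gram d (coord d p) *m (chart_jac c d p)^T.
Proof.
move=> cp dp; rewrite time_chart_jac// /time_gram /= !row_mxKr.
rewrite tr_block_mx !trmx0 trmx1 !mulmx_block.
rewrite !(mulmx0, mul0mx, mulmx1, mul1mx, addr0, add0r).
by rewrite (gram_change g cp dp).
Qed.

(* $-dt^2+g$ *)
Definition time_metric : metric time_product :=
  Metric time_gram_smooth time_gram_sym time_gram_unit time_gram_change.

End Product.

(* Main.v *)
(* The R-factor is flat and the time component of gamma is affine, so the j-th
   covariant derivative of gamma' is (0, d2^(j+1) nabla^j alpha') for j >= 1, and
   the curvature terms only see the components along N. Each term of the
   r-tension carries the factor d2^(2r), hence tau_r(gamma) = (0, d2^(2r)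
   tau_r(alpha)).
   If (T, F, B) is the Frenet frame of alpha, with curvature k and torsion tau,
   the frame of gamma has normal (0, F) and binormal
   (- d1 d2^2 k, - d2 d1^2 k T + d2 tau B) / t, with curvature d2^2 k and torsion
   t = |d2| sqrt(d1^2 k^2 + tau^2), which is positive even if tau <= 0. *)
From mathcomp Require Import all_boot all_order all_algebra.
From mathcomp Require Import all_classical all_reals all_analysis.
From mathcomp Require Import ring zify.
Require Import Defs.

Set Implicit Arguments.
Unset Strict Implicit.
Unset Printing Implicit Defensive.

Import Order.TTheory GRing.Theory Num.Theory.
Import numFieldNormedType.Exports.

Local Open Scope classical_set_scope.
Local Open Scope ring_scope.

(** * Limits and derivatives of row vectors, with a time coordinate adjoined *)

Section Calculus.
Context {R : realType}.

Lemma eq_lim_fmap (T : Type) (U : pnbhsType) (F : set_system T) (f h : T -> U) :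
  f =1 h -> lim (f x @[x --> F]) = lim (h x @[x --> F]).
Proof. by move=> /funext ->. Qed.

Lemma point_rV n : (point : 'rV[R]_n) = 0.
Proof. by apply/rowP => i; rewrite /point /= !mxE. Qed.

(* No convergence is assumed: a left inverse of [L] transports convergence back,
   so if one limit does not exist, both sides are the junk value [0]. Hence the
   derivative formulas below without differentiability hypotheses. *)
Lemma lim_cancel_linear n p (L : {linear 'rV[R]_n -> 'rV[R]_p})
    (P : {linear 'rV[R]_p -> 'rV[R]_n}) (T : Type) (F : set_system T)
    (f : T -> 'rV[R]_n) : ProperFilter F -> cancel L P ->
  lim (L (f x) @[x --> F]) = L (lim (f x @[x --> F])).
Proof.
move=> FF LK; have [fl|nfl] := pselect (cvg (f x @[x --> F])).
  apply: cvg_lim => //; apply: continuous_cvg fl.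
  exact: linear_mx_continuous.
suff nLfl : ~ cvg (L (f x) @[x --> F]).
  by rewrite (dvgP nfl) (dvgP nLfl) !point_rV linear0.
pose g := L \o f => gl; apply: nfl; apply/cvg_ex; exists (P (lim (g @ F))).
have -> : f = P \o g by apply/funext => x /=; rewrite LK.
exact: cvg_comp _ _ gl (@linear_mx_continuous _ _ _ _ P _).
Qed.

Lemma lim_scale n (a : R) (T : Type) (F : set_system T) (f : T -> 'rV[R]_n) :
  ProperFilter F -> a != 0 ->
  lim (a *: f x @[x --> F]) = a *: lim (f x @[x --> F]).
Proof.
move=> FF a0.
apply: (@lim_cancel_linear _ _ ( *:%R a : {linear _ -> _})
  ( *:%R a^-1 : {linear _ -> _})) => //.
by move=> v /=; rewrite scalerA mulVf ?scale1r.
Qed.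

Lemma derive1_scale n (f : R -> 'rV[R]_n) (a s : R) : a != 0 ->
  derive1 (fun t => a *: f t) s = a *: derive1 f s.
Proof.
move=> a0; rewrite /derive1 -lim_scale//; apply: eq_lim_fmap => h.
by rewrite -scalerBr !scalerA mulrC.
Qed.

(** A dilation and its inverse both preserve punctured neighbourhoods of 0. This equality of filters
    permits a change of variable in a difference quotient even when its limit fails to exist. *)
Lemma dnbhs0_dilate (a : R) : a != 0 -> (a * h) @[h --> (0 : R)^'] = (0 : R)^'.
Proof.
have H (b : R) (A : set R) : b != 0 -> (0 : R)^' A ->
    \forall h \near (0 : R)^', A (b * h).
  move=> b0 A0; rewrite near_withinE.
  have := @mulrl_continuous R b 0; rewrite /continuous_at mulr0 => /(_ _ A0).
  by apply: (@filterS _ (nbhs (0 : R))) => h /= Ah h0; apply: Ah; rewrite mulf_neq0.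
move=> a0; apply/seteqP; split => A; last exact: H.
move=> /(H a^-1) /=; rewrite invr_eq0 => /(_ a0).
by apply: filterS => h /=; rewrite mulrA mulfV// mul1r.
Qed.

Lemma derive1_dilate n (f : R -> 'rV[R]_n) (a s : R) : a != 0 ->
  derive1 (fun t => f (a * t)) s = a *: derive1 f (a * s).
Proof.
move=> a0; rewrite /derive1 -lim_scale// -[in RHS](dnbhs0_dilate a0).
congr lim; apply/funext => A; rewrite /fmap /=; congr (_ _).
apply/funext => h /=; congr (A _).
by rewrite invfM scalerA mulrA mulfV// mul1r mulrDr.
Qed.

(** Serves both for the coordinates of a point of the product and for a tangent vector, [a] being
    then its coefficient along the time direction. *)
Definition time_vec n (a : R) (v : 'rV[R]_n) : 'rV[R]_(1 + n) :=
  row_mx (const_mx a) v.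

Lemma time_vecE n a (v : 'rV[R]_n) :
  time_vec a v = time_vec a 0 + mulmxr (inr_mx (R := R)) v.
Proof.
by rewrite /time_vec /= mul_mx_row mulmx0 mulmx1 add_row_mx addr0 add0r.
Qed.

(** With time component 0 the map is linear and has the left inverse [rsubmx], so
    [lim_cancel_linear] applies. *)
Lemma lim_time_vec n (T : Type) (F : set_system T) (f : T -> 'rV[R]_n) :
  ProperFilter F ->
  lim (time_vec 0 (f x) @[x --> F]) = time_vec 0 (lim (f x @[x --> F])).
Proof.
move=> FF; have t0 : time_vec 0 0 = 0 :> 'rV[R]_(1 + n).
  by rewrite /time_vec -[0 in RHS]row_mx0; congr row_mx; apply/rowP => i; rewrite !mxE.
have tE v : time_vec 0 v = mulmxr (inr_mx (R := R)) v :> 'rV[R]_(1 + n).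
  by rewrite time_vecE t0 add0r.
under eq_fun do rewrite tE.
rewrite tE (@lim_cancel_linear _ _ _ rsubmx) // => v /=.
by rewrite mul_mx_row row_mxKr mulmx1.
Qed.

Lemma time_vecB n a (u v : 'rV[R]_n) :
  time_vec a u - time_vec a v = time_vec 0 (u - v).
Proof.
rewrite /time_vec opp_row_mx add_row_mx; congr row_mx.
by apply/rowP => i; rewrite !mxE subrr.
Qed.

Lemma time_vecD n a b (u v : 'rV[R]_n) :
  time_vec a u + time_vec b v = time_vec (a + b) (u + v).
Proof.
by rewrite /time_vec add_row_mx; congr row_mx; apply/rowP => i; rewrite !mxE.
Qed.

Lemma time_vecZ n a b (v : 'rV[R]_n) :
  b *: time_vec a v = time_vec (b * a) (b *: v).
Proof.
by rewrite /time_vec scale_row_mx; congr row_mx; apply/rowP => i; rewrite !mxE.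
Qed.

Lemma derive_time_vec n (W : normedModType R) (f : W -> 'rV[R]_n) a (x w : W) :
  'D_w (fun y => time_vec a (f y)) x = time_vec 0 ('D_w f x).
Proof.
rewrite /derive -lim_time_vec; apply: eq_lim_fmap => h /=.
by rewrite time_vecB time_vecZ mulr0.
Qed.

Lemma derive1_time_vec n (f : R -> 'rV[R]_n) (a b s : R) : b != 0 ->
  derive1 (fun t => time_vec a (f (b * t))) s =
  time_vec 0 (b *: derive1 f (b * s)).
Proof.
move=> b0; rewrite -(derive1_dilate _ _ b0) !derive1E.
exact: derive_time_vec.
Qed.

(** The order starts at 1: one derivative kills the constant time component, which is still present
    at order 0. *)
Lemma derive1n_time_vec n (f : R -> 'rV[R]_n) (a b : R) k : b != 0 ->
  derive1n k.+1 (fun t => time_vec a (f (b * t))) =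
  fun s => time_vec 0 (b ^+ k.+1 *: derive1n k.+1 f (b * s)).
Proof.
move=> b0; elim: k => [|k IH].
  by apply/funext => s; rewrite /derive1n /= derive1_time_vec.
rewrite derive1nS {}IH; apply/funext => s.
rewrite (derive1_time_vec (fun u => b ^+ k.+1 *: derive1n k.+1 f u))//.
rewrite derive1_scale ?expf_neq0// -derive1nS.
by rewrite scalerA -exprS.
Qed.

Lemma derivable_time_vec n (f : R -> 'rV[R]_n) (a b s : R) :
  derivable f (b * s) 1 -> derivable (fun t => time_vec a (f (b * t))) s 1.
Proof.
move=> /derivable1_diffP df; apply/derivable1_diffP.
under eq_fun do rewrite time_vecE.
apply: differentiableD; first exact: differentiable_cst.
apply: (@differentiable_comp _ _ _ _ (fun t => f (b * t)) (mulmxr inr_mx)).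
  exact: differentiable_comp.
apply: linear_differentiable; exact: linear_mx_continuous.
Qed.

Lemma derivable1n_time_vec n (f : R -> 'rV[R]_n) (a b s : R) : b != 0 ->
  (forall k, derivable (derive1n k f) (b * s) 1) ->
  forall k, derivable (derive1n k (fun t => time_vec a (f (b * t)))) s 1.
Proof.
move=> b0 df [|k]; first exact: derivable_time_vec (df 0%N).
rewrite derive1n_time_vec//.
apply: (@derivable_time_vec _ (fun u => b ^+ k.+1 *: derive1n k.+1 f u)).
exact: derivableZ.
Qed.

Lemma is_derive_time_vec_line n (f : R -> 'rV[R]_n) (a b s : R) : b != 0 ->
  derivable f (b * s) 1 ->
  is_derive s 1 (fun t => time_vec (a * t) (f (b * t)))
    (time_vec a (b *: derive1 f (b * s))).
Proof.
move=> b0 df; have dv := @derivable_time_vec n f 0 b s df.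
(* The time coordinate is no longer constant; it is split off as a linear path, leaving a path with
   time coordinate 0. *)
have -> : (fun t => time_vec (a * t) (f (b * t))) =
    (fun t => t *: time_vec a 0) + (fun t => time_vec 0 (f (b * t))).
  by apply/funext => t /=; rewrite fctE time_vecZ time_vecD scaler0 addr0 add0r mulrC.
have -> : time_vec a (b *: derive1 f (b * s)) =
    time_vec a 0 + time_vec 0 (b *: derive1 f (b * s)).
  by rewrite time_vecD addr0 add0r.
apply: is_deriveD; last first.
  split=> //; rewrite -derive1E; exact: derive1_time_vec.
have dt := is_diff_scalel s (time_vec a 0 : 'rV[R]_(1 + n)).
split; first by apply/derivable1_diffP; case: dt.
by rewrite deriveE; case: dt => // _ ->; rewrite scale1r.
Qed.

Lemma near_derive1n (W : normedModType R) (f h : R -> W) (s : R) k :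
  (\forall u \near s, f u = h u) ->
  \forall u \near s, derive1n k f u = derive1n k h u.
Proof.
move=> fh; elim: k => [//|k IH].
(* Agreement at the single point [u] would not determine the derivative there; [near_join] provides
   agreement on a neighbourhood of each nearby [u]. *)
apply: filterS (near_join IH) => u fhu.
by rewrite !derive1nS !derive1E; exact: near_eq_derive.
Qed.

Lemma derivable1n_near (W : normedModType R) (f h : R -> W) (s : R) :
  (\forall u \near s, f u = h u) ->
  (forall k, derivable (derive1n k f) s 1) ->
  forall k, derivable (derive1n k h) s 1.
Proof. by move=> fh df k; apply: near_eq_derivable (near_derive1n k fh) (df k). Qed.

Lemma derive1_lin_comb (W : normedModType R) (f h : R -> W) (a b s : R) :
  derivable f s 1 -> derivable h s 1 ->
  derive1 (fun u => a *: f u + b *: h u) s = a *: derive1 f s + b *: derive1 h s.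
Proof.
move=> df dh; rewrite !derive1E -[LHS]/('D_1 (a *: f + b *: h : R -> W) s).
by rewrite deriveD ?deriveZ//; exact: derivableZ.
Qed.

Lemma derivable1n_lin_comb (W : normedModType R) (U : set R) (f h : R -> W)
    (a b : R) : open U ->
  (forall s, U s -> forall k, derivable (derive1n k f) s 1) ->
  (forall s, U s -> forall k, derivable (derive1n k h) s 1) ->
  forall s, U s -> forall k,
    derivable (derive1n k (fun u => a *: f u + b *: h u)) s 1.
Proof.
move=> oU df dh.
have H k : forall s, U s -> derive1n k (fun u => a *: f u + b *: h u) s =
    a *: derive1n k f s + b *: derive1n k h s.
  elim: k => [//|k IH] s Us; rewrite !derive1nS.
  rewrite derive1E (@near_eq_derive _ _ _ _
    (fun u => a *: derive1n k f u + b *: derive1n k h u)); last first.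
    by apply: filterS IH _; exact: open_nbhs_nbhs.
  by rewrite -derive1E derive1_lin_comb//; [exact: df|exact: dh].
move=> s Us k; apply: (@near_eq_derivable _ _ _
  (a *: derive1n k f + b *: derive1n k h : R -> W)).
  by apply: filterS (fun u Uu => esym (H k u Uu)) _; exact: open_nbhs_nbhs.
by apply: derivableD; apply: derivableZ; [exact: df|exact: dh].
Qed.

End Calculus.

(** * Bilinearity, and vector fields along curves *)

Section Curves.
Context {R : realType} {n : nat} {M : manifold R n} (g : metric M).
Implicit Types (c d : chart M) (x u v w : 'rV[R]_n).
Implicit Types (I : set R) (gamma : R -> M) (V W : chart M -> R -> 'rV[R]_n).

Lemma innerDl c x u v w : inner g c x (u + v) w = inner g c x u w + inner g c x v w.
Proof. by rewrite /inner !mulmxDl mxE. Qed.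

Lemma innerZl c x a u w : inner g c x (a *: u) w = a * inner g c x u w.
Proof. by rewrite /inner -!scalemxAl mxE. Qed.

Lemma innerDr c x u v w : inner g c x u (v + w) = inner g c x u v + inner g c x u w.
Proof. by rewrite /inner linearD mulmxDr mxE. Qed.

Lemma innerZr c x a u w : inner g c x u (a *: w) = a * inner g c x u w.
Proof. by rewrite /inner linearZ -scalemxAr mxE. Qed.

Lemma innerC (c : chart M) x u v : codom c x -> inner g c x u v = inner g c x v u.
Proof.
move=> cx; transitivity ((u *m gram g c x *m v^T)^T 0 0); first by rewrite [RHS]mxE.
by rewrite !trmx_mul trmxK (gram_sym g cx) mulmxA.
Qed.

Lemma christoffel_mapDr c x u v w :
  christoffel_map g c x u (v + w) = christoffel_map g c x u v + christoffel_map g c x u w.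
Proof.
apply/rowP => k; rewrite !mxE -big_split; apply: eq_bigr => i _ /=.
by rewrite -big_split; apply: eq_bigr => j _ /=; rewrite !mxE mulrDr.
Qed.

Lemma christoffel_mapZr c x a u v :
  christoffel_map g c x u (a *: v) = a *: christoffel_map g c x u v.
Proof.
apply/rowP => k; rewrite !mxE mulr_sumr; apply: eq_bigr => i _ /=.
by rewrite mulr_sumr; apply: eq_bigr => j _ /=; rewrite !mxE mulrCA.
Qed.

Lemma christoffel_mapZl c x a u v :
  christoffel_map g c x (a *: u) v = a *: christoffel_map g c x u v.
Proof.
apply/rowP => k; rewrite !mxE mulr_sumr; apply: eq_bigr => i _ /=.
rewrite mulr_sumr; apply: eq_bigr => j _ /=; rewrite !mxE; ring.
Qed.

Lemma covd_along_lin_comb gamma V W a b c s :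
  derivable (V c) s 1 -> derivable (W c) s 1 ->
  covd_along g gamma (fun c s => a *: V c s + b *: W c s) c s =
  a *: covd_along g gamma V c s + b *: covd_along g gamma W c s.
Proof.
move=> dV dW; rewrite /covd_along christoffel_mapDr !christoffel_mapZr.
rewrite (derive1_lin_comb a b dV dW) !scalerDr addrACA //.
Qed.

Lemma covd_along_scale gamma V a c s : a != 0 ->
  covd_along g gamma (fun c s => a *: V c s) c s = a *: covd_along g gamma V c s.
Proof.
by move=> a0; rewrite /covd_along christoffel_mapZr derive1_scale// scalerDr.
Qed.

(** Homogeneity is read off the constant-curvature formula, which spares differentiating the
    Christoffel symbols. *)
Lemma curvature_scale k c x u v w a b e : constant_curvature g k -> codom c x ->
  curvature g c x (a *: u) (b *: v) (e *: w) = (a * b * e) *: curvature g c x u v w.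
Proof.
move=> gk cx; rewrite !gk// !innerZl !innerZr !scalerBr !scalerA.
by congr (_ *: _ - _ *: _); ring.
Qed.

Lemma times_codom I gamma c s : times I gamma c s -> codom c (coord c (gamma s)).
Proof. by move=> [_ cs]; exists (gamma s). Qed.

Lemma times_open I gamma c : open I -> smooth_curve I gamma -> open (times I gamma c).
Proof.
move=> oI [gc _]; rewrite openE => s [Is cs].
apply: filterI; first by apply: open_nbhs_nbhs.
by apply: (gc s Is); apply: open_nbhs_nbhs; split => //; exact: dom_open.
Qed.

Lemma near_times I gamma c s : open (times I gamma c) -> times I gamma c s ->
  \forall t \near s, times I gamma c t.
Proof. by move=> ot cs; exact: open_nbhs_nbhs. Qed.

Lemma velocity_change I gamma c d s : open I -> smooth_curve I gamma ->
  times I gamma c s -> dom d (gamma s) ->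
  velocity gamma d s = velocity gamma c s *m chart_jac c d (gamma s).
Proof.
move=> oI gs cs ds; pose x := coord c \o gamma.
have dx : differentiable x s by apply/derivable1_diffP; exact: (gs.2 c s cs 0%N).
have df : differentiable (coord d \o param c) (x s).
  by apply: (smooth_on_differentiable (transition_smooth (c := c) (d := d)));
    exists (gamma s) => //; split => //; exact: cs.2.
(* Near [s] the curve stays in the domain of [c], so its expression in [d] is the transition map
   applied to its expression in [c]; the chain rule then yields the Jacobian. *)
rewrite /velocity !derive1E (@near_eq_derive _ _ _ _ ((coord d \o param c) \o x)).
  rewrite deriveE; last exact: differentiable_comp.
  by rewrite diff_comp//= -(deriveE (1 : R^o) dx) -deriveE// deriveEjacobian.
by apply: filterS (near_times (times_open oI gs) cs) => t [_ ct]; rewrite /x /= coordK.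
Qed.

Lemma field_along_velocity I gamma : open I -> smooth_curve I gamma ->
  field_along I gamma (velocity gamma).
Proof.
move=> oI gs; split=> [c s cs k|c d s cs ds]; last exact: velocity_change cs ds.
by rewrite /velocity -derive1Sn; exact: gs.2.
Qed.

Lemma field_along_lin_comb I gamma V W a b : open I -> smooth_curve I gamma ->
  field_along I gamma V -> field_along I gamma W ->
  field_along I gamma (fun c s => a *: V c s + b *: W c s).
Proof.
move=> oI gs [Vd Vc] [Wd Wc]; split=> [c s cs k|c d s cs ds].
  apply: (derivable1n_lin_comb (times_open oI gs)) cs k.
  - exact: Vd.
  - exact: Wd.
by rewrite (Vc c d s)// (Wc c d s)// mulmxDl -!scalemxAl.
Qed.

Lemma field_along_scale I gamma V a : open I -> smooth_curve I gamma ->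
  field_along I gamma V -> field_along I gamma (fun c s => a *: V c s).
Proof.
move=> oI gs Vf; have -> : (fun c s => a *: V c s) = fun c s => a *: V c s + 0 *: V c s.
  by apply/funext => c; apply/funext => s; rewrite scale0r addr0.
exact: field_along_lin_comb.
Qed.

End Curves.

(** * Christoffel symbols and curvature of the product metric *)

Section Product.
Context {R : realType} {n : nat} {N : manifold R n} (g : metric N).
Implicit Types (c : chart N) (x u v w : 'rV[R]_(1 + n)).

Let gprod := time_metric g.

Lemma inner_time c x a b (u v : 'rV[R]_n) :
  inner gprod c x (time_vec a u) (time_vec b v) =
  - (a * b) + inner g c (rsubmx x) u v.
Proof.
rewrite /inner /= /time_gram /time_vec mul_row_block !mulmx0 addr0 add0r.
rewrite mul_mx_scalar tr_row_mx mul_row_col mxE; congr (_ + _).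
by rewrite mxE big_ord1 !mxE mulN1r mulNr.
Qed.

Lemma dgram_time c x (i j l : 'I_n) :
  dgram gprod c (rshift 1 i) (rshift 1 j) (rshift 1 l) x =
  dgram g c i j l (rsubmx x).
Proof.
rewrite /dgram /pderiv.
have -> : (fun y => gram gprod c y (rshift 1 j) (rshift 1 l)) =
    (fun z => gram g c z j l) \o rsubmx.
  by apply/funext => y; rewrite /= block_mxEdr.
rewrite derive_rsubmx; congr ('D_ _ _ _); apply/rowP => k.
by rewrite !mxE eqxx eq_rshift.
Qed.

(** The Gram matrix reads the point only through [rsubmx], which sends the time direction to 0. *)
Lemma dgram_time0 c x i j l : dgram gprod c (lshift n i) j l x = 0.
Proof.
rewrite /dgram /pderiv.
have -> : (fun y => gram gprod c y j l) =
    (fun z => block_mx (-1)%:M 0 0 (gram g c z) j l) \o rsubmx by [].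
rewrite derive_rsubmx.
have -> : rsubmx (delta_mx 0 (lshift n i)) = 0 :> 'rV[R]_n.
  by apply/rowP => k; rewrite !mxE eqxx eq_rlshift.
exact: derive0.
Qed.

Lemma dgram_time1 c x i j l : dgram gprod c j (lshift n i) l x = 0.
Proof.
rewrite /dgram /pderiv.
case: (split_ordP l) => l' ->.
  under eq_fun do rewrite /= block_mxEul.
  exact: derive_cst.
under eq_fun do rewrite /= block_mxEur mxE.
exact: derive_cst.
Qed.

Lemma dgram_time2 c x i j l : dgram gprod c j l (lshift n i) x = 0.
Proof.
rewrite /dgram /pderiv.
case: (split_ordP l) => l' ->.
  under eq_fun do rewrite /= block_mxEul.
  exact: derive_cst.
under eq_fun do rewrite /= block_mxEdl mxE.
exact: derive_cst.
Qed.

Lemma invmx_gram_time (c : chart (time_product N)) x : codom c x ->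
  invmx (gram gprod c x) = block_mx (invmx (-1)%:M) 0 0 (invmx (gram g c (rsubmx x))).
Proof. by move=> cx; apply: invmx_block_diag; exact: (gram_unit gprod cx). Qed.

Lemma christoffel_time (c : chart (time_product N)) x (k i j : 'I_n) : codom c x ->
  christoffel gprod c x (rshift 1 k) (rshift 1 i) (rshift 1 j) =
  christoffel g c (rsubmx x) k i j.
Proof.
move=> cx; rewrite /christoffel invmx_gram_time// big_split_ord big_ord1 /=.
rewrite block_mxEdl mxE mul0r add0r; congr (_ * _); apply: eq_bigr => l _.
by rewrite block_mxEdr !dgram_time.
Qed.

(** If [i] or [j] is the time index, every derivative in the bracket vanishes. If [k] is, the
    block-diagonal inverse keeps only the time value of [l], for which the bracket vanishes
    again. *)
Lemma christoffel_time0 (c : chart (time_product N)) x a i j : codom c x ->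
  [/\ christoffel gprod c x (lshift n a) i j = 0,
      christoffel gprod c x i (lshift n a) j = 0 &
      christoffel gprod c x i j (lshift n a) = 0].
Proof.
move=> cx; have dE := (dgram_time0, dgram_time1, dgram_time2).
by split; rewrite /christoffel invmx_gram_time// big_split_ord big_ord1 /= !dE;
  rewrite !addr0 subrr mulr0 add0r big1 ?mulr0// => l _;
  rewrite ?dE ?block_mxEur ?mxE ?mul0r// !addr0 subrr mulr0.
Qed.

Lemma christoffel_map_time (c : chart (time_product N)) x u v : codom c x ->
  christoffel_map gprod c x u v =
  time_vec 0 (christoffel_map g c (rsubmx x) (rsubmx u) (rsubmx v)).
Proof.
move=> cx; have C0 a i j := christoffel_time0 a i j cx.
apply/rowP => k; rewrite [LHS]mxE; case: (split_ordP k) => k' ->.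
  rewrite /time_vec row_mxEl [RHS]mxE big1// => i _; rewrite big1// => j _.
  by have [-> _ _] := C0 k' i j; rewrite !mul0r.
rewrite /time_vec row_mxEr mxE big_split_ord big_ord1 /= big1 ?add0r; last first.
  by move=> j _; have [_ -> _] := C0 ord0 (rshift 1 k') j; rewrite !mul0r.
apply: eq_bigr => i _; rewrite big_split_ord big_ord1 /=.
have [_ _ ->] := C0 ord0 (rshift 1 k') (rshift 1 i); rewrite !mul0r add0r.
by apply: eq_bigr => j _; rewrite christoffel_time// !mxE.
Qed.

Lemma rsubmx_time_vec a (v : 'rV[R]_n) : rsubmx (time_vec a v) = v.
Proof. exact: row_mxKr. Qed.

(** The constant time component of [Y] differentiates to 0, so the result has the same shape as [Y]
    and the lemma can be iterated, as the curvature requires. *)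
Lemma covd_time (c : chart (time_product N)) (X Y : 'rV[R]_(1 + n) -> 'rV[R]_(1 + n))
    (X' Y' : 'rV[R]_n -> 'rV[R]_n) a x :
  codom c x -> rsubmx (X x) = X' (rsubmx x) ->
  (forall y, codom c y -> Y y = time_vec a (Y' (rsubmx y))) ->
  covd gprod c X Y x = time_vec 0 (covd g c X' Y' (rsubmx x)).
Proof.
move=> cx XX YY; rewrite /covd christoffel_map_time// YY// rsubmx_time_vec XX.
rewrite (@near_eq_derive _ _ _ _ (fun y => time_vec a ((Y' \o rsubmx) y))); last first.
  by apply: filterS (codom_near cx) => y cy; rewrite YY.
by rewrite derive_time_vec derive_rsubmx XX time_vecD addr0.
Qed.

Lemma curvature_time (c : chart (time_product N)) x u v w : codom c x ->
  curvature gprod c x u v w =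
  time_vec 0 (curvature g c (rsubmx x) (rsubmx u) (rsubmx v) (rsubmx w)).
Proof.
move=> cx; have wE y : codom c y -> cst w y = time_vec (lsubmx w 0 0) (cst (rsubmx w) (rsubmx y)).
  move=> _; rewrite /time_vec -[LHS]hsubmxK; congr row_mx.
  by apply/rowP => i; rewrite !mxE !ord1.
have E z y : codom c y -> covd gprod c (cst z) (cst w) y =
    time_vec 0 (covd g c (cst (rsubmx z)) (cst (rsubmx w)) (rsubmx y)).
  by move=> cy; exact: covd_time wE.
rewrite /curvature /curvature_field.
rewrite (covd_time (X' := cst (rsubmx u)) cx _ (E v))//.
rewrite (covd_time (X' := cst (rsubmx v)) cx _ (E u))//.
rewrite (covd_time (X' := lie (cst (rsubmx u)) (cst (rsubmx v))) cx _ wE).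
  by rewrite !time_vecB.
(* Constant fields commute, both upstairs and on [N]. *)
by rewrite /lie !derive_cst !subrr; apply/rowP => i; rewrite !mxE.
Qed.

End Product.

(** * Covariant derivatives and tension of the product curve *)

Section ProductCurve.
Context {R : realType} {n : nat} {N : manifold R n} (g : metric N).
Variables (I : set R) (alpha : R -> N) (d1 d2 : R).
Hypotheses (d20 : d2 != 0) (oI : open I) (alpha_smooth : smooth_curve I alpha).

Let gprod := time_metric g.
Let gamma : R -> time_product N := fun s => (d1 * s, alpha (d2 * s)).
Let J : set R := [set s | I (d2 * s)].

Implicit Types (c : chart (time_product N)) (V : chart N -> R -> 'rV[R]_n).

(** The charts of the product are indexed by those of [N], so [c] is passed to [V] as it is; only
    the time is rescaled. *)
Definition time_field (a : R) V : chart (time_product N) -> R -> 'rV[R]_(1 + n) :=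
  fun c s => time_vec a (V c (d2 * s)).

Lemma coord_time c : coord c \o gamma =
  fun s => time_vec (d1 * s) (coord (c : chart N) (alpha (d2 * s))).
Proof. by []. Qed.

Lemma open_time : open J.
Proof.
by apply: open_comp oI => s _; exact: mulrl_continuous.
Qed.

Lemma velocity_time c s : times J gamma c s ->
  velocity gamma c s = time_field d1 (fun c s => d2 *: velocity alpha c s) c s.
Proof.
move=> cs; rewrite /velocity coord_time derive1E.
have dx := alpha_smooth.2 _ _ (cs : times I alpha c (d2 * s)) 0%N.
exact: (derive_val (is_derive := is_derive_time_vec_line d1 d20 dx)).
Qed.

Lemma open_times_time c : open (times J gamma c).
Proof.
have -> : times J gamma c = *%R d2 @^-1` times I alpha (c : chart N) by [].
apply: open_comp; last exact: times_open.
by move=> s _; exact: mulrl_continuous.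
Qed.

Lemma field_along_time a V : field_along I alpha V -> field_along J gamma (time_field a V).
Proof.
move=> [Vd Vc]; split=> [c s cs k|c d s cs ds].
  by apply: derivable1n_time_vec => //; exact: Vd cs.
rewrite time_chart_jac//; last exact: cs.2.
rewrite /time_field (Vc c d (d2 * s))//.
by rewrite /time_vec mul_row_block !mulmx0 addr0 add0r mulmx1.
Qed.

Lemma smooth_curve_time : smooth_curve J gamma.
Proof.
split=> [s Js|c s cs].
  apply: (cvg_pair (F := nbhs s) (G := nbhs (d1 * s))
    (H := nbhs (alpha (d2 * s)))).
    exact: mulrl_continuous.
  apply: (@continuous_cvg _ _ _ _ _ _ alpha); first exact: alpha_smooth.1.
  exact: mulrl_continuous.
case=> [|k].
  rewrite coord_time.
  have dx := alpha_smooth.2 _ _ (cs : times I alpha c (d2 * s)) 0%N.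
  exact: (ex_derive (is_derive := is_derive_time_vec_line d1 d20 dx)).
(* From order 1 on, the derivatives are those of the velocity, which near [s] is a field with
   constant time component [d1]. *)
rewrite derive1Sn; apply: derivable1n_near k.
  apply: filterS (near_times (@open_times_time c) cs) => t ct.
  exact/esym/velocity_time.
apply: (field_along_time d1 _).1 cs.
by apply: field_along_scale => //; exact: field_along_velocity.
Qed.

(** The factor [d2] has two sources: the rescaled time in the ordinary derivative, and the velocity
    of [gamma] in the Christoffel term. [W] is compared with a [time_field] only at the times of the
    chart, which is all that an induction on iterated derivatives supplies. *)
Lemma covd_along_time a V (W : chart (time_product N) -> R -> 'rV[R]_(1 + n)) c s :
  times J gamma c s ->
  (forall t, times J gamma c t -> W c t = time_field a V c t) ->
  covd_along gprod gamma W c s =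
  time_field 0 (fun c s => d2 *: covd_along g alpha V c s) c s.
Proof.
move=> cs WV; rewrite /covd_along christoffel_map_time; last exact: times_codom cs.
rewrite velocity_time// WV// /time_field !rsubmx_time_vec.
rewrite derive1E (@near_eq_derive _ _ _ _ (time_field a V c)).
  rewrite -derive1E derive1_time_vec// time_vecD addr0; congr time_vec.
  by rewrite scalerDr christoffel_mapZl.
by apply: filterS (near_times (@open_times_time c) cs) => t ct; exact: WV.
Qed.

(** The time component [d1] of the velocity is constant, so it survives only for [j = 0]. *)
Lemma nablaT_time j c s : times J gamma c s ->
  nablaT gprod gamma j c s =
  time_field (if j is 0 then d1 else 0) (fun c s => d2 ^+ j.+1 *: nablaT g alpha j c s) c s.
Proof.
elim: j s => [|j IH] s cs; first by rewrite expr1; exact: velocity_time.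
rewrite /nablaT /= (covd_along_time cs IH) /time_field; congr time_vec.
rewrite covd_along_scale ?expf_neq0//.
by rewrite scalerA -exprS.
Qed.

Lemma rsubmx_nablaT_time j c s : times J gamma c s ->
  rsubmx (nablaT gprod gamma j c s) = d2 ^+ j.+1 *: nablaT g alpha j c (d2 * s).
Proof. by move=> cs; rewrite nablaT_time// rsubmx_time_vec. Qed.

Lemma tension_time k r c s : constant_curvature g k -> (2 <= r)%N ->
  times J gamma c s ->
  tension gprod r gamma c s =
  time_field 0 (fun c s => d2 ^+ (2 * r) *: tension g r alpha c s) c s.
Proof.
move=> gk r2 cs; rewrite /tension /time_field scalerDr -[0 in RHS]addr0 -time_vecD.
congr (_ + _).
  rewrite nablaT_time// /time_field.
  (* Exhibiting a successor makes the [match] in [nablaT_time] select the time component 0. *)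
  have -> : (2 * r - 1 = (2 * r - 2).+1)%N by lia.
  by congr (time_vec 0 (_ ^+ _ *: _)); lia.
rewrite scaler_sumr (big_morph (time_vec 0) (id1 := 0) (op1 := +%R)).
- apply: eq_big_nat => l /andP[_ lr]; rewrite curvature_time; last exact: times_codom cs.
  rewrite !rsubmx_nablaT_time// velocity_time// rsubmx_time_vec row_mxKr.
  rewrite (curvature_scale _ _ _ _ _ _ gk); last by exact: (@times_codom _ _ _ I alpha c (d2 * s)).
  rewrite time_vecZ mulr0 !scalerA -exprD -exprSr mulrC.
  (* The exponents [(2 * r - 3 - l).+1], [l.+1] and 1 add up to [2 * r]; the subtraction is not
     truncated because [l < r - 1]. *)
  by congr (time_vec 0 ((_ ^+ _ * _) *: _)); lia.
- by move=> u v; rewrite time_vecD addr0.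
- by apply/rowP => i; rewrite /time_vec -[in RHS]row_mx0; congr (row_mx _ _ _ _).
Qed.

Lemma inner_along_time a b V W c s :
  inner_along gprod gamma c s (time_field a V c s) (time_field b W c s) =
  - (a * b) + inner_along g alpha c (d2 * s) (V c (d2 * s)) (W c (d2 * s)).
Proof. by rewrite /inner_along inner_time row_mxKr. Qed.

End ProductCurve.

(** Positivity excludes -1 for a nonzero vector, and the zero vector has square 0. This recovers the
    signs of the Frenet frame of [alpha], which [helix3] leaves existential. *)
Lemma riemannian_sign (R : realType) n (M : manifold R n) (g : metric M)
    (c : chart M) x v e :
  riemannian g -> codom c x -> is_sign e -> inner g c x v v = e -> e = 1.
Proof.
move=> gr cx [//|->] ve; have [v0|v0] := eqVneq v 0.
  move: ve; rewrite v0 /inner !mul0mx mxE => /eqP.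
  by rewrite eq_sym oppr_eq0 oner_eq0.
by have := gr c x cx v v0; rewrite ve oppr_gt0 ltr10.
Qed.

(** * The product curve is time-like, proper harmonic and a helix *)

Section Helix.
Context {R : realType} {n : nat} {N : manifold R n} (g : metric N).
Variables (I : set R) (alpha : R -> N) (d1 d2 : R).
Hypotheses (d20 : d2 != 0) (d12 : d1 ^+ 2 = d2 ^+ 2 + 1).
Hypothesis alpha_unit : arclength_curve g I alpha 1.

Let gprod := time_metric g.
Let gamma : R -> time_product N := fun s => (d1 * s, alpha (d2 * s)).
Let J : set R := [set s | I (d2 * s)].

Lemma timelike_time : timelike_curve gprod J gamma.
Proof.
have [[oI iI [s0 Is0]] [sm _ vv]] := alpha_unit.
split; split.
- exact: open_time.
- move=> x y Jx Jy z /andP[xz zy]; rewrite /J /= in Jx Jy *.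
  (* A negative [d2] reverses the order, hence exchanges the two endpoints. *)
  have [d2p|d2n] := ltP 0 d2.
    by apply: (iI _ _ Jx Jy); rewrite !ler_pM2l// xz zy.
  by apply: (iI _ _ Jy Jx); rewrite !ler_wnM2l.
- by exists (d2^-1 * s0); rewrite /J /= mulrA mulfV// mul1r.
- exact: smooth_curve_time.
- by right.
- move=> c s cs; rewrite (velocity_time (d1 := d1) d20 sm cs) inner_along_time.
  have := vv _ _ (cs : times I alpha c (d2 * s)).
  rewrite /inner_along innerZl innerZr => ->.
  by rewrite -expr2 d12; ring.
Qed.

Lemma proper_harmonic_time k r : constant_curvature g k -> (2 <= r)%N ->
  proper_harmonic g r I alpha -> proper_harmonic gprod r J gamma.
Proof.
have [[oI _ _] [sm _ _]] := alpha_unit.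
move=> gk r2 [ha ng]; split=> [c s cs|gg].
  rewrite (tension_time (d1 := d1) d20 oI sm gk r2 cs) /time_field ha// scaler0.
  exact: row_mx0.
(* If [gamma] were a geodesic, the spatial part of its acceleration at [t], which is [d2 ^+ 2] times
   that of [alpha] at [s], would vanish. *)
apply: ng => c s cs; pose t := d2^-1 * s.
have st : s = d2 * t by rewrite /t mulrA mulfV// mul1r.
rewrite st in cs *; have := gg c t cs.
move/(congr1 rsubmx); rewrite (rsubmx_nablaT_time g (d1 := d1) d20 oI sm)// linear0 => /eqP.
by rewrite scaler_eq0 expf_eq0 (negbTE d20) andbF => /eqP.
Qed.

(** The conclusion with [None] demands a positive torsion, whereas [alpha] may have any real torsion
    when [o] is an orientation. *)
Lemma helix3_time o : riemannian g -> helix3 g o I alpha -> helix3 gprod None J gamma.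
Proof.
move=> gr [e1 [e2 [e3 [k [tau [Nf [B F]]]]]]].
have [[oI iI [s0 Is0]] [sm _ vv]] := alpha_unit.
(* Signs and curvatures being constants, one time [s0] and one chart around [alpha s0] suffice to
   determine the signs and to get [0 < k]. *)
have [c0 cs0] := dom_cover (alpha s0).
have ts0 : times I alpha c0 s0 by [].
have cx0 := times_codom ts0.
have [NN BB _ _ _] := frenet_frame F ts0.
have [e2s e3s] := frenet_signs F.
have {}e21 : e2 = 1 := riemannian_sign gr cx0 e2s NN.
have {}e31 : e3 = 1 := riemannian_sign gr cx0 e3s BB.
have e11 : e1 = 1.
  by have [_ [_ _ vv1]] := frenet_curve F; rewrite -(vv1 _ _ ts0) vv.
have k0 : 0 < k := frenet_k_gt0 F Is0.
rewrite {}e11 {}e21 {}e31 in F => {NN BB e2s e3s}.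
pose S := d1 ^+ 2 * k ^+ 2 + tau ^+ 2.
have d1p : 0 < d1 ^+ 2 by rewrite d12 ltr_wpDl ?sqr_ge0.
have S0 : 0 < S by rewrite /S ltr_pwDl ?sqr_ge0// mulr_gt0// exprn_gt0.
(* The absolute value keeps the torsion positive when [d2 < 0]; the sign of [d2] is carried by the
   coefficients of the binormal. *)
pose t := `|d2| * Num.sqrt S.
have t0 : 0 < t by rewrite mulr_gt0 ?normr_gt0 ?sqrtr_gt0.
have tn0 : t != 0 by rewrite gt_eqF.
have t2 : t * t = d2 ^+ 2 * S.
  by rewrite -expr2 /t exprMn real_normK ?num_real// sqr_sqrtr// ltW.
(* These solve the second Frenet equation for the binormal: with first sign -1 and curvature
   [d2 ^+ 2 * k], [t] times the binormal is (0, d2 (- k T + tau B)) minus d2^2 k (d1, d2 T). The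
   coefficient of T is - d2 k (1 + d2^2) = - d2 d1^2 k. *)
pose b0 := - (d1 * d2 ^+ 2 * k / t).
pose b1 := - (d2 * d1 ^+ 2 * k / t).
pose b2 := d2 * tau / t.
(* The identities below are multiplied by [t] where necessary, so that only these products and
   [t * t] occur and the square root is never unfolded again. *)
have tb0 : t * b0 = - (d1 * d2 ^+ 2 * k) by rewrite /b0; field.
have tb1 : t * b1 = - (d2 * d1 ^+ 2 * k) by rewrite /b1; field.
have tb2 : t * b2 = d2 * tau by rewrite /b2; field.
pose Bf := fun c s => b1 *: velocity alpha c s + b2 *: B c s.
have Tf := field_along_velocity oI sm.
have Bff : field_along I alpha Bf.
  by apply: field_along_lin_comb => //; exact: frenet_B F.
exists (-1), 1, 1, (d2 ^+ 2 * k), t, (time_field d2 0 Nf), (time_field d2 b0 Bf).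
split.
- exact: timelike_time.
- by split; left.
- by apply: field_along_time => //; exact: frenet_N F.
- exact: field_along_time.
- move=> c s cs ip T; have [NN BB TN TB NB] := frenet_frame F cs.
  have cx := times_codom (cs : times I alpha c (d2 * s)).
  have TT := vv _ _ (cs : times I alpha c (d2 * s)).
  rewrite /inner_along in NN BB TN TB NB TT.
  rewrite /T (velocity_time (d1 := d1) d20 sm cs) /ip !inner_along_time /Bf /inner_along.
  have NT := TN; rewrite innerC// in NT; have BT := TB; rewrite innerC// in BT.
  rewrite !(innerDl, innerDr, innerZl, innerZr) NN BB TN TB NB TT NT BT.
  split; rewrite ?(mul0r, mulr0, mulr1, addr0, add0r, oppr0)//.
    (* The binormal has square 1: after multiplication by [t * t], the factor
       [d1 ^+ 2 - d2 ^+ 2 = 1] turns its square into [d2 ^+ 2 * S]. *)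
    apply: (mulfI (mulf_neq0 tn0 tn0)).
    transitivity (- (t * b0) ^+ 2 + (t * b1) ^+ 2 + (t * b2) ^+ 2); first by ring.
    rewrite tb0 tb1 tb2 mulr1 t2 /S.
    transitivity (d2 ^+ 2 * (d1 ^+ 2 * k ^+ 2 * (d1 ^+ 2 - d2 ^+ 2) + tau ^+ 2)).
      by ring.
    by rewrite d12; ring.
  apply: (mulfI tn0); transitivity (- (d1 * (t * b0)) + d2 * (t * b1)); first by ring.
  by rewrite tb0 tb1; ring.
- move=> c s cs; have [eT eN eB] := frenet_eq F cs.
  have cs' : times I alpha (c : chart N) (d2 * s) := cs.
  have dT : derivable (velocity alpha c) (d2 * s) 1 := Tf.1 c _ cs 0%N.
  have dB : derivable (B c) (d2 * s) 1 := (frenet_B F).1 c _ cs 0%N.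
  rewrite /= in eT eN eB; split.
  + rewrite (covd_along_time g (d1 := d1) d20 oI sm cs (fun u cu => velocity_time d20 sm cu)).
    rewrite /time_field covd_along_scale// eT time_vecZ !scalerA.
    by congr (time_vec _ (_ *: _)); rewrite /= ?mulr0//; ring.
  + rewrite (covd_along_time g (d1 := d1) d20 oI sm (a := 0) (V := Nf) cs)//.
    rewrite (velocity_time (d1 := d1) d20 sm cs) /time_field eN.
    rewrite !time_vecZ time_vecD /Bf; congr time_vec.
    * by rewrite /= mul1r tb0; ring.
    * rewrite /= !scalerDr !scalerA !mul1r tb1 tb2 addrA -scalerDl.
      congr (_ *: _ + _ *: _).
      (* Inserting the factor [d1 ^+ 2 - d2 ^+ 2 = 1] splits the T-coefficient into the parts due to
         the binormal and to the velocity. *)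
      have -> : d2 * - k = - (d2 * k) * (d1 ^+ 2 - d2 ^+ 2) by rewrite d12; ring.
      by ring.
  + rewrite (covd_along_time g (d1 := d1) d20 oI sm (a := b0) (V := Bf) cs)//.
    rewrite /time_field covd_along_lin_comb// eT eB !time_vecZ /= mulr0; congr time_vec.
    rewrite !scalerA -scalerDl scalerA !mul1r; congr (_ *: _).
    (* Both the T and B terms of the binormal differentiate to multiples of the normal; the total
       coefficient is [- t] precisely because [t * t = d2 ^+ 2 * S]. *)
    apply: (mulfI tn0); transitivity (- (t * t)); last by rewrite mulrN.
    rewrite t2.
    transitivity (d2 * ((t * b1) * k - (t * b2) * tau)); first by ring.
    by rewrite tb1 tb2 /S; ring.
- by move=> s _ /=; rewrite mulr_gt0// exprn_even_gt0.
- by [].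
Qed.

End Helix.

Theorem corollary1p27 (R : realType) (c : R) (m r : nat)
    (N : manifold R m.-1) (g : metric N) (o : option (orientation N))
    (I : set R) (alpha : R -> N) (d1 d2 : R) :
  c != 0 -> (4 <= m)%N -> (2 <= r)%N ->
  space_form g c ->
  arclength_curve g I alpha 1 ->
  proper_harmonic g r I alpha ->
  helix3 g o I alpha ->
  d1 != 0 -> d2 != 0 -> d1 ^+ 2 = d2 ^+ 2 + 1 ->
  let gprod : metric (time_product N) := time_metric g in
  let gamma : R -> time_product N := fun s => (d1 * s, alpha (d2 * s)) in
  let J : set R := [set s | I (d2 * s)] in
  [/\ timelike_curve gprod J gamma,
      proper_harmonic gprod r J gamma &
      helix3 gprod None J gamma].
Proof.
move=> _ _ r2 [gr gc] au ha hh _ d20 d12 gprod gamma J; split.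
- exact: timelike_time.
- exact: (proper_harmonic_time d1 d20 au gc r2 ha).
- exact: helix3_time hh.
Qed.
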